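(* Let $R_c,\kappa_1,\kappa_2>0$ and $c_1,c_2\ge 0$ be constants, let $k_{min}>0$ be fixed, and let $k_{max}=\pi/h$. The solution $p^\ast=p^\ast(h)$ of the min-max problem $$\min_{p>0}\ \max_{k\in[k_{min},k_{max}]}|\rho_{SR}(k,p)|$$ has, for small $h>0$, the asymptotic expansion $$p^\ast=C_p+O(h),$$ where $C_p$ is a (positive) constant, independent of $h$, determined by the nonlinear equation $G_{k_{min}}(C_p)=G_{k_{max}}(C_p)$, with $$G_{k_{min}}(C_p)=\frac{\kappa_1\kappa_2(\hat\varphi_1(k_{min})-\hat\varphi_1(C_p))(\hat\varphi_2(k_{min})-\hat\varphi_2(C_p))}{\hat\varphi_3\,\hat\varphi_4},\qquad G_{k_{max}}(C_p)=\frac{1}{(R_c\kappa_1\hat\varphi_1(C_p)+1)(R_c\kappa_2\hat\varphi_2(C_p)+1)} .$$ Furthermore, $$\max_{k_{min}\le k\le k_{max}}\rho_{SR}(k,p^\ast)=G_{k_{max}}(C_p)+O(h),$$ where $G_{k_{max}}(C_p)<1$ is a positive constant independent of $h$.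
   Context: For $i=1,2$ let $\xi_i(k)=\frac{1}{\sqrt{c_i\kappa_i+\kappa_i^2k^2}}$ and $$\rho_{SR}(k,p)=\frac{\xi_1(p)-\xi_1(k)}{\xi_1(p)+R_c+\xi_2(k)}\cdot\frac{\xi_2(p)-\xi_2(k)}{\xi_2(p)+R_c+\xi_1(k)}$$ (convergence factor of the optimized Schwarz method with scaled Robin transmission condition). Put $\eta_i=c_i/\kappa_i$, $\hat\varphi_i(x)=\sqrt{x^2+\eta_i}$ for $i=1,2$, and $$\hat\varphi_3=\kappa_1(R_c\kappa_2\hat\varphi_2(C_p)+1)\hat\varphi_1(k_{min})+\kappa_2\hat\varphi_2(C_p),\qquad \hat\varphi_4=\kappa_2(R_c\kappa_1\hat\varphi_1(C_p)+1)\hat\varphi_2(k_{min})+\kappa_1\hat\varphi_1(C_p).$$ The notation $O(h)$ is as $h\to0^+$ with all other parameters fixed. *)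

(* Defs.v *)
From mathcomp Require Import all_boot all_order all_algebra.
From mathcomp Require Import all_classical all_reals all_analysis.

Set Implicit Arguments.
Unset Strict Implicit.
Unset Printing Implicit Defensive.

Import Order.TTheory GRing.Theory Num.Theory.
Import numFieldNormedType.Exports.

Local Open Scope classical_set_scope.
Local Open Scope ring_scope.

Definition xi (R : realType) (c kappa k : R) : R :=
  (Num.sqrt (c * kappa + kappa ^+ 2 * k ^+ 2))^-1.

Definition rhoSR (R : realType) (Rc kappa1 kappa2 c1 c2 k p : R) : R :=
  (xi c1 kappa1 p - xi c1 kappa1 k) /
    (xi c1 kappa1 p + Rc + xi c2 kappa2 k) *
  ((xi c2 kappa2 p - xi c2 kappa2 k) /
    (xi c2 kappa2 p + Rc + xi c1 kappa1 k)).

Definition phihat (R : realType) (c kappa x : R) : R :=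
  Num.sqrt (x ^+ 2 + c / kappa).

Definition phihat3 (R : realType) (Rc kappa1 kappa2 c1 c2 kmin C : R) : R :=
  kappa1 * (Rc * kappa2 * phihat c2 kappa2 C + 1) * phihat c1 kappa1 kmin
  + kappa2 * phihat c2 kappa2 C.

Definition phihat4 (R : realType) (Rc kappa1 kappa2 c1 c2 kmin C : R) : R :=
  kappa2 * (Rc * kappa1 * phihat c1 kappa1 C + 1) * phihat c2 kappa2 kmin
  + kappa1 * phihat c1 kappa1 C.

Definition Gkmin (R : realType) (Rc kappa1 kappa2 c1 c2 kmin C : R) : R :=
  kappa1 * kappa2 * (phihat c1 kappa1 kmin - phihat c1 kappa1 C)
    * (phihat c2 kappa2 kmin - phihat c2 kappa2 C)
  / (phihat3 Rc kappa1 kappa2 c1 c2 kmin C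
     * phihat4 Rc kappa1 kappa2 c1 c2 kmin C).

Definition Gkmax (R : realType) (Rc kappa1 kappa2 c1 c2 C : R) : R :=
  1 / ((Rc * kappa1 * phihat c1 kappa1 C + 1)
       * (Rc * kappa2 * phihat c2 kappa2 C + 1)).

(* [sup] is total; it is a genuine maximum when [f] is continuous and
   [a <= b], see [max_on_attained]. *)
Definition max_on (R : realType) (f : R -> R) (a b : R) : R :=
  sup (f @` `[a, b]).

Definition minmax_solution (R : realType)
    (Rc kappa1 kappa2 c1 c2 kmin kmax p : R) : Prop :=
  let worst q :=
    max_on (fun k => `|rhoSR Rc kappa1 kappa2 c1 c2 k q|) kmin kmax in
  0 < p /\ forall q : R, 0 < q -> worst p <= worst q.

Lemma max_on_attained (R : realType) (f : R -> R) (a b : R) :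
  a <= b -> {within `[a, b], continuous f} ->
  (exists2 k, k \in `[a, b] & f k = max_on f a b) /\
  (forall k, k \in `[a, b] -> f k <= max_on f a b).
Proof.
move=> ab fc; have [m mab mmax] := EVT_max ab fc.
have ub : ubound (f @` `[a, b]) (f m) by move=> _ [k kab <-]; exact: mmax.
have e : max_on f a b = f m.
  apply/eqP; rewrite eq_le; apply/andP; split.
    by apply: ge_sup => //; exists (f m), m.
  by apply: ub_le_sup; [exists (f m)|exists m].
by rewrite e; split => //; exists m.
Qed.

Lemma xi_gt0 (R : realType) (c kappa k : R) :
  0 <= c -> 0 < kappa -> 0 < k -> 0 < xi c kappa k.
Proof.
move=> c0 kap0 k0; rewrite invr_gt0 sqrtr_gt0.
by rewrite ltr_wpDl ?mulr_gt0 ?exprn_gt0// mulr_ge0// ltW.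
Qed.

Lemma xi_continuous (R : realType) (c kappa k : R) :
  0 <= c -> 0 < kappa -> 0 < k -> {for k, continuous (xi c kappa)}.
Proof.
move=> c0 kap0 k0; apply: cvgV.
  by rewrite -invr_eq0 gt_eqF// xi_gt0.
apply: continuous_comp; last exact: sqrt_continuous.
apply: cvgD; first exact: cvg_cst.
apply: cvgM; first exact: cvg_cst.
exact: exprn_continuous.
Qed.

Lemma rhoSR_continuous (R : realType) (Rc kappa1 kappa2 c1 c2 a b p : R) :
  0 < Rc -> 0 < kappa1 -> 0 < kappa2 -> 0 <= c1 -> 0 <= c2 ->
  0 < a -> 0 < p ->
  {within `[a, b], continuous (fun k => rhoSR Rc kappa1 kappa2 c1 c2 k p)}.
Proof.
move=> Rc0 kap1 kap2 c10 c20 a0 p0.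
apply: continuous_in_subspaceT => k; rewrite inE/= in_itv/= => /andP[ak _].
have k0 : 0 < k by exact: lt_le_trans ak.
have F c kappa c' kappa' : 0 < kappa -> 0 < kappa' -> 0 <= c -> 0 <= c' ->
  {for k, continuous (fun k => (xi c kappa p - xi c kappa k) /
    (xi c kappa p + Rc + xi c' kappa' k))}.
  move=> kap kap' ? ?; apply: cvgM.
    by apply: cvgB; [exact: cvg_cst|exact: xi_continuous].
  apply: cvgV; first by rewrite gt_eqF// !addr_gt0// xi_gt0.
  by apply: cvgD; [exact: cvg_cst|exact: xi_continuous].
by apply: cvgM; exact: F.
Qed.

(* Main.v *)
Require Import Defs.
From mathcomp Require Import all_boot all_order all_algebra.
From mathcomp Require Import all_classical all_reals all_analysis.
From mathcomp Require Import ring lra.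

(** Both symbols [xi] are positive and strictly decreasing, so the two factors
of [rhoSR k p] always have the same sign and [rhoSR] is nonnegative.  For fixed
[k] each factor is a strictly decreasing function of [p] vanishing at [p = k];
hence [rhoSR k] strictly decreases on ]0, k] and strictly increases on
[k, +oo[ ([rhoSR_decr], [rhoSR_incr]).  Exchanging the denominators shows that
[rhoSR] is symmetric in its two arguments ([rhoSR_sym]), so the same
monotonicity holds in [k], and the maximum over [kmin, kmax] is the larger of
the two endpoint values.  As [p] runs through ]kmin, kmax[, the value at [kmin]
increases from 0 while the value at [kmax] decreases to 0.  They cross at
exactly one point, and this equioscillation point is the unique minimizer:
moving [p] either way raises one of the two endpoint values
([minmax_solution_equioscillation]).

Since [xi k = (kappa * phihat k)^-1], the function [Gkmin] is [rhoSR kmin], and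
[Gkmax] is the limit of [rhoSR kmax] as [kmax] tends to infinity, that is, as
the symbols at [kmax] are replaced by 0.  The same crossing argument gives
[Cp].  At and below [kmin] there is no second crossing, because a value of
[rhoSR] there is strictly smaller than its limit ([rhoSR_lt_Gkmax]).

The rate comes from comparing values.  Uniformly in [p <= kmax], [Gkmax p]
exceeds [rhoSR kmax p] by a positive amount that is at most a constant
times [xi1 kmax + xi2 kmax], which is O(h) ([Gkmax_sub_rhoSR]).
Comparing the two equioscillation equations gives [p <= Cp] and
[Gkmax p - Gkmax Cp = O(h)], and likewise for the optimal value
([equioscillation_rate]).  Finally [Gkmax] decreases at least linearly to the
left of [Cp] ([Gkmax_sub_ge]), so the bound on [Gkmax] becomes a bound on
[Cp - p].  The function [rhoSR kmin] could not play this role, since it has a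
double zero at [kmin] and no linear lower bound there. *)

Set Implicit Arguments.
Unset Strict Implicit.

Import Order.TTheory GRing.Theory Num.Theory.
Import numFieldNormedType.Exports.

Local Open Scope classical_set_scope.
Local Open Scope ring_scope.

(** * The symbols xi and phihat *)

Section Symbol.
Variables (R : realType) (c kappa : R).
Hypotheses (c_ge0 : 0 <= c) (kappa_gt0 : 0 < kappa).

Lemma phihat_gt0 k : 0 < k -> 0 < phihat c kappa k.
Proof.
by move=> k0; rewrite sqrtr_gt0 ltr_wpDr ?exprn_gt0// divr_ge0// ltW.
Qed.

Lemma phihat_lt p q : 0 < p -> p < q -> phihat c kappa p < phihat c kappa q.
Proof.
move=> p0 pq; have q0 := lt_trans p0 pq.
rewrite ltr_sqrt ?ltrD2r; last first.
  by rewrite ltr_wpDr ?exprn_gt0// divr_ge0// ltW.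
by rewrite ltr_pXn2r// nnegrE ltW.
Qed.

Lemma sqr_phihat k : phihat c kappa k ^+ 2 = k ^+ 2 + c / kappa.
Proof. by rewrite sqr_sqrtr// addr_ge0 ?sqr_ge0// divr_ge0// ltW. Qed.

Lemma xi_phihat k : xi c kappa k = (kappa * phihat c kappa k)^-1.
Proof.
rewrite /xi /phihat; congr (_^-1).
have -> : c * kappa + kappa ^+ 2 * k ^+ 2 = kappa ^+ 2 * (k ^+ 2 + c / kappa).
  by field; rewrite gt_eqF.
by rewrite sqrtrM ?sqr_ge0// sqrtr_sqr ger0_norm// ltW.
Qed.

Lemma xi_lt p q : 0 < p -> p < q -> xi c kappa q < xi c kappa p.
Proof.
move=> p0 pq; have q0 := lt_trans p0 pq.
rewrite !xi_phihat ltf_pV2 ?posrE ?mulr_gt0 ?phihat_gt0//.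
by rewrite ltr_pM2l// phihat_lt.
Qed.

Lemma xi_le k : 0 < k -> xi c kappa k <= (kappa * k)^-1.
Proof.
move=> k0; rewrite xi_phihat lef_pV2 ?posrE ?mulr_gt0 ?phihat_gt0//.
rewrite ler_pM2l// /phihat -[leLHS](ger0_norm (ltW k0)) -sqrtr_sqr.
by apply: ler_wsqrtr; rewrite lerDl divr_ge0// ltW.
Qed.

(** The difference of the square roots is the difference of the squares over
the sum of the roots; [q + p] is bounded below by [q] and the sum of the roots
above by twice the larger one, which gives a slope that does not depend on
[p]. *)
Lemma phihat_sub_ge p q : 0 < p -> p <= q ->
  q / (2 * phihat c kappa q) * (q - p) <= phihat c kappa q - phihat c kappa p.
Proof.
move=> p0 pq; have q0 := lt_le_trans p0 pq.
have x0 := phihat_gt0 p0; have y0 := phihat_gt0 q0.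
have xy : phihat c kappa p <= phihat c kappa q.
  by move: pq; rewrite le_eqVlt => /predU1P[->//|/(phihat_lt p0)/ltW].
have := sqr_phihat p; have := sqr_phihat q.
move: (phihat c kappa p) (phihat c kappa q) x0 y0 xy => x y x0 y0 xy ey ex.
by rewrite mulrAC ler_pdivrMr ?mulr_gt0//; nra.
Qed.

Lemma phihat_continuous : continuous (phihat c kappa).
Proof.
move=> x; apply: continuous_comp; last exact: sqrt_continuous.
by apply: cvgD; [exact: exprn_continuous|exact: cvg_cst].
Qed.

End Symbol.

(** * Auxiliary inequalities and maxima *)

(** The function [A |-> (A - a) / (A + r + b)] is the shape of each factor of
[rhoSR], with [a] and [b] the symbols at the frequency and [A] the symbol at the
parameter; its derivative has numerator [a + b + r > 0]. *)
Lemma mobius_lt (R : realFieldType) (r a b A A' : R) :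
  0 < r -> 0 <= a -> 0 <= b -> 0 <= A -> A < A' ->
  (A - a) / (A + r + b) < (A' - a) / (A' + r + b).
Proof.
move=> r0 a0 b0 A0 AA'.
have d0 : 0 < A + r + b by lra.
have d0' : 0 < A' + r + b by lra.
by rewrite ltr_pdivrMr// mulrAC ltr_pdivlMr//; nra.
Qed.

(** The cost of replacing the symbols [a], [b] at the cut-off frequency by
their limit 0. *)
Lemma mobius_shift (R : realFieldType) (r a b A : R) :
  0 < r -> 0 <= a -> 0 <= b -> 0 < A -> 
  A / (A + r) - (A - a) / (A + r + b) <= (a + b) / r.
Proof.
move=> r0 a0 b0 A0.
have d0 : 0 < A + r by lra.
have d0' : 0 < A + r + b by lra.
have -> : A / (A + r) - (A - a) / (A + r + b)
    = (A * b + a * (A + r)) / ((A + r + b) * (A + r)).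
  by field; rewrite !gt_eqF.
rewrite ler_pdivrMr ?mulr_gt0// mulrAC ler_pdivlMr//.
have ? : 0 <= A * b by rewrite mulr_ge0// ltW.
have ? : 0 <= a * A by rewrite mulr_ge0// ltW.
have ? : 0 <= a * b by rewrite mulr_ge0.
have ? : 0 <= A * A by rewrite mulr_ge0// ltW.
have ? : 0 <= A * r by rewrite mulr_ge0// ltW.
by nra.
Qed.

Lemma mulr_sub_le (R : realDomainType) (u v f g e : R) :
  0 <= u <= 1 -> 0 <= g <= 1 -> 0 <= e -> u - f <= e -> v - g <= e ->
  u * v - f * g <= 2 * e.
Proof.
move=> /andP[u0 u1] /andP[g0 g1] e0 uf vg.
have -> : u * v - f * g = u * (v - g) + g * (u - f) by ring.
rewrite [2 * e]mulr_natl mulr2n; apply: lerD; nra.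
Qed.

Lemma max_onE (R : realType) (f : R -> R) (a b m : R) :
  a <= m <= b -> (forall k, a <= k <= b -> f k <= f m) -> max_on f a b = f m.
Proof.
move=> mab fm; apply/eqP; rewrite eq_le; apply/andP; split.
  apply: ge_sup; first by exists (f m), m => //=; rewrite in_itv.
  by move=> _ [k kab <-]; apply: fm; move: kab; rewrite /= in_itv.
apply: ub_le_sup; last by exists m => //=; rewrite in_itv.
by exists (f m) => _ [k kab <-]; apply: fm; move: kab; rewrite /= in_itv.
Qed.

Lemma exists_crossing (R : realType) (f g : R -> R) (a b : R) : a < b ->
  {within `[a, b], continuous f} -> {within `[a, b], continuous g} ->
  f a < g a -> g b < f b -> exists2 x, a < x < b & f x = g x.
Proof.
move=> ab fc gc fga gfb.
have fgc : {within `[a, b], continuous (fun x => f x - g x)}.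
  by move=> x; apply: cvgB; [exact: fc|exact: gc].
have ha : f a - g a < 0 by rewrite subr_lt0.
have hb : 0 < f b - g b by rewrite subr_gt0.
have [|x] := @IVT _ _ a b 0 (ltW ab) fgc.
  by rewrite ge_min le_max (ltW ha) (ltW hb) orbT.
rewrite in_itv/= => /andP[ax xb] /eqP; rewrite subr_eq0 => /eqP e.
exists x => //; rewrite !lt_neqAle ax xb !andbT.
apply/andP; split; apply/eqP => E.
  by move: fga; rewrite E e ltxx.
by move: gfb; rewrite -E e ltxx.
Qed.

(** * The convergence factor *)

Section ConvergenceFactor.
Variables (R : realType) (Rc kappa1 kappa2 c1 c2 : R).
Hypotheses (Rc_gt0 : 0 < Rc) (kappa1_gt0 : 0 < kappa1) (kappa2_gt0 : 0 < kappa2).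
Hypotheses (c1_ge0 : 0 <= c1) (c2_ge0 : 0 <= c2).

Local Notation xi1 := (xi c1 kappa1).
Local Notation xi2 := (xi c2 kappa2).
Local Notation rho := (rhoSR Rc kappa1 kappa2 c1 c2).
Local Notation rhoinf := (Gkmax Rc kappa1 kappa2 c1 c2).

Let xi1_gt0 k : 0 < k -> 0 < xi1 k. Proof. exact: xi_gt0. Qed.
Let xi2_gt0 k : 0 < k -> 0 < xi2 k. Proof. exact: xi_gt0. Qed.

(** Exchanging [k] and [p] flips the sign of both numerators and swaps the two
denominators. *)
Lemma rhoSR_sym k p : 0 < k -> 0 < p -> rho k p = rho p k.
Proof.
move=> k0 p0; rewrite /rhoSR.
have := xi1_gt0 k0; have := xi1_gt0 p0; have := xi2_gt0 k0; have := xi2_gt0 p0.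
move: (xi1 k) (xi1 p) (xi2 k) (xi2 p) => a A b B ? ? ? ?.
by have r0 := Rc_gt0; field; apply/andP; split; apply: lt0r_neq0; lra.
Qed.

Lemma rhoSR_diag k : rho k k = 0.
Proof. by rewrite /rhoSR subrr !mul0r. Qed.

(** [rhoSR k p] is convertible to [factor1 k p * factor2 k p]. *)
Let factor1 k p := (xi1 p - xi1 k) / (xi1 p + Rc + xi2 k).
Let factor2 k p := (xi2 p - xi2 k) / (xi2 p + Rc + xi1 k).

Let factor1_diag k : factor1 k k = 0.
Proof. by rewrite /factor1 subrr mul0r. Qed.

Let factor2_diag k : factor2 k k = 0.
Proof. by rewrite /factor2 subrr mul0r. Qed.

Let factor1_lt k p q : 0 < k -> 0 < p -> p < q -> factor1 k q < factor1 k p.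
Proof.
move=> k0 p0 pq; apply: mobius_lt => //; last exact: xi_lt.
all: by rewrite ltW// ?xi1_gt0 ?xi2_gt0// (lt_trans p0 pq).
Qed.

Let factor2_lt k p q : 0 < k -> 0 < p -> p < q -> factor2 k q < factor2 k p.
Proof.
move=> k0 p0 pq; apply: mobius_lt => //; last exact: xi_lt.
all: by rewrite ltW// ?xi1_gt0 ?xi2_gt0// (lt_trans p0 pq).
Qed.

Let factor_ge0 k p : 0 < p -> p <= k -> 0 <= factor1 k p /\ 0 <= factor2 k p.
Proof.
move=> p0; rewrite le_eqVlt => /predU1P[->|pk].
  by rewrite factor1_diag factor2_diag.
have k0 := lt_trans p0 pk.
split; apply: ltW.
  by rewrite -(factor1_diag k) factor1_lt.
by rewrite -(factor2_diag k) factor2_lt.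
Qed.

Let factor_le0 k p : 0 < k -> k <= p -> factor1 k p <= 0 /\ factor2 k p <= 0.
Proof.
move=> k0; rewrite le_eqVlt => /predU1P[<-|kp].
  by rewrite factor1_diag factor2_diag.
split; apply: ltW.
  by rewrite -(factor1_diag k) factor1_lt.
by rewrite -(factor2_diag k) factor2_lt.
Qed.

Lemma rhoSR_decr k p q : 0 < p -> p < q -> q <= k -> rho k q < rho k p.
Proof.
move=> p0 pq qk; have q0 := lt_trans p0 pq; have k0 := lt_le_trans q0 qk.
have [? ?] := factor_ge0 q0 qk.
by apply: ltr_pM => //; [exact: factor1_lt|exact: factor2_lt].
Qed.

Lemma rhoSR_incr k p q : 0 < k -> k <= p -> p < q -> rho k p < rho k q.
Proof.
move=> k0 kp pq; have p0 := lt_le_trans k0 kp.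
have [? ?] := factor_le0 k0 kp.
rewrite -[rho k p]mulrNN -[rho k q]mulrNN.
apply: ltr_pM; rewrite ?oppr_ge0// ltrN2.
  exact: factor1_lt.
exact: factor2_lt.
Qed.

Lemma rhoSR_ge0 k p : 0 < k -> 0 < p -> 0 <= rho k p.
Proof.
move=> k0 p0; have [pk|/ltW kp] := leP p k.
  by have [? ?] := factor_ge0 p0 pk; exact: mulr_ge0.
by have [? ?] := factor_le0 k0 kp; exact: mulr_le0.
Qed.

(** By symmetry [k |-> rhoSR k p] decreases up to [p] and increases after it, so
the endpoint on the far side of [k] from [p] dominates. *)
Lemma rhoSR_le_max a b k p : 0 < p -> 0 < a -> a <= k <= b ->
  rho k p <= Num.max (rho a p) (rho b p).
Proof.
move=> p0 a0 /andP[ak kb]; have k0 := lt_le_trans a0 ak.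
have b0 := lt_le_trans k0 kb.
rewrite le_max !(rhoSR_sym _ p0)//; have [pk|kp] := leP p k.
  move: kb; rewrite le_eqVlt => /predU1P[->|kb]; first by rewrite lexx orbT.
  by rewrite (ltW (rhoSR_incr p0 pk kb)) orbT.
move: ak; rewrite le_eqVlt => /predU1P[->|ak]; first by rewrite lexx.
by rewrite (ltW (rhoSR_decr a0 ak (ltW kp))).
Qed.

Lemma max_on_rhoSR a b p : 0 < p -> 0 < a -> a <= b ->
  max_on (fun k => rho k p) a b = Num.max (rho a p) (rho b p).
Proof.
move=> p0 a0 ab.
have H k : a <= k <= b -> rho k p <= _ := @rhoSR_le_max _ _ _ _ p0 a0.
have [h|h] := leP (rho a p) (rho b p).
  by apply: (@max_onE _ _ _ _ b) => [|k /H]; rewrite ?lexx ?andbT// (max_idPr h).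
apply: (@max_onE _ _ _ _ a) => [|k /H]; first by rewrite lexx.
by rewrite (max_idPl (ltW h)).
Qed.

Lemma max_on_norm_rhoSR a b p : 0 < p -> 0 < a -> a <= b ->
  max_on (fun k => `|rho k p|) a b = Num.max (rho a p) (rho b p).
Proof.
move=> p0 a0 ab; rewrite -max_on_rhoSR//; congr sup; apply/seteqP.
have E k : k \in `[a, b] -> `|rho k p| = rho k p.
  by rewrite in_itv/= => /andP[ak _]; rewrite ger0_norm// rhoSR_ge0// (lt_le_trans a0).
by split=> _ [k kab <-]; exists k; rewrite // E.
Qed.

(** * The limit of infinite cut-off frequency *)

(** This is [rhoSR k p] with the symbols at [k] replaced by 0, and is the form
that can be compared with [rhoSR]. *)
Lemma GkmaxE p : 0 < p ->
  rhoinf p = xi1 p / (xi1 p + Rc) * (xi2 p / (xi2 p + Rc)).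
Proof.
move=> p0; have r0 := Rc_gt0; rewrite /Gkmax !xi_phihat//.
have := phihat_gt0 c1_ge0 kappa1_gt0 p0; have := phihat_gt0 c2_ge0 kappa2_gt0 p0.
move: (phihat c1 _ _) (phihat c2 _ _) => x y y0 x0.
have ? : 0 < Rc * kappa1 * x by rewrite !mulr_gt0.
have ? : 0 < Rc * kappa2 * y by rewrite !mulr_gt0.
by field; rewrite !gt_eqF//=; lra.
Qed.

Lemma GkminE k p : 0 < k -> 0 < p ->
  Gkmin Rc kappa1 kappa2 c1 c2 k p = rho k p.
Proof.
move=> k0 p0; have r0 := Rc_gt0; rewrite /Gkmin /rhoSR /phihat3 /phihat4 !xi_phihat//.
have := phihat_gt0 c1_ge0 kappa1_gt0 p0; have := phihat_gt0 c2_ge0 kappa2_gt0 p0.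
have := phihat_gt0 c1_ge0 kappa1_gt0 k0; have := phihat_gt0 c2_ge0 kappa2_gt0 k0.
move: (phihat c1 _ k) (phihat c2 _ k) (phihat c1 _ p) (phihat c2 _ p).
move=> x y z t y0 x0 t0 z0.
have ? : 0 < kappa1 * z by rewrite !mulr_gt0.
have ? : 0 < kappa2 * t by rewrite !mulr_gt0.
have ? : 0 < kappa1 * x by rewrite !mulr_gt0.
have ? : 0 < kappa2 * y by rewrite !mulr_gt0.
have ? : 0 < Rc * (kappa1 * z) * (kappa2 * y) by rewrite !mulr_gt0.
have ? : 0 < Rc * (kappa1 * x) * (kappa2 * t) by rewrite !mulr_gt0.
by field; rewrite !gt_eqF//=; lra.
Qed.

Lemma Gkmax_gt0 p : 0 < p -> 0 < rhoinf p.
Proof.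
move=> p0; rewrite divr_gt0// mulr_gt0// ltr_wpDl// !mulr_ge0 ?sqrtr_ge0//.
all: exact: ltW.
Qed.

Lemma Gkmax_lt1 p : 0 < p -> rhoinf p < 1.
Proof.
move=> p0; have r0 := Rc_gt0; rewrite GkmaxE//; have := xi1_gt0 p0; have := xi2_gt0 p0.
move: (xi1 p) (xi2 p) => A B B0 A0.
rewrite mulr_ilt1//; [rewrite divr_ge0//; lra..| |].
  by rewrite ltr_pdivrMr; lra.
by rewrite ltr_pdivrMr; lra.
Qed.

Lemma Gkmax_lt p q : 0 < p -> p < q -> rhoinf q < rhoinf p.
Proof.
move=> p0 pq; have q0 := lt_trans p0 pq; have r0 := Rc_gt0; rewrite !GkmaxE//.
have D x y : 0 < x -> x < y -> x / (x + Rc) < y / (y + Rc).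
  move=> x0 xy; have y0 := lt_trans x0 xy.
  rewrite ltr_pdivrMr ?addr_gt0// mulrAC ltr_pdivlMr ?addr_gt0//; nra.
apply: ltr_pM; rewrite ?divr_ge0 ?addr_ge0// ?ltW ?xi1_gt0 ?xi2_gt0//.
all: by rewrite D ?xi1_gt0 ?xi2_gt0// xi_lt.
Qed.

Lemma Gkmax_le p q : 0 < p -> p <= q -> rhoinf q <= rhoinf p.
Proof. by move=> p0; rewrite le_eqVlt => /predU1P[->//|/(Gkmax_lt p0)/ltW]. Qed.

Lemma rhoSR_lt_Gkmax k p : 0 < p -> p <= k -> rho k p < rhoinf p.
Proof.
move=> p0 pk; have k0 := lt_le_trans p0 pk; have r0 := Rc_gt0; rewrite GkmaxE//.
have [? ?] := factor_ge0 p0 pk.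
have D A a b : 0 < A -> 0 < a -> 0 < b ->
    (A - a) / (A + Rc + b) < A / (A + Rc).
  move=> A0 a0 b0; rewrite ltr_pdivrMr ?addr_gt0// mulrAC.
  by rewrite ltr_pdivlMr ?addr_gt0//; nra.
by apply: ltr_pM => //; apply: D; rewrite ?xi1_gt0 ?xi2_gt0.
Qed.

(** Each of the two factors moves by at most [(xi1 k + xi2 k) / Rc], and all the
factors lie in [[0, 1]]. *)
Lemma Gkmax_sub_rhoSR k p : 0 < p -> p <= k ->
  rhoinf p - rho k p <= 2 * (xi1 k + xi2 k) / Rc.
Proof.
move=> p0 pk; have k0 := lt_le_trans p0 pk; have r0 := Rc_gt0; rewrite GkmaxE//.
have [] := factor_ge0 p0 pk.
have := @mobius_shift _ Rc (xi1 k) (xi2 k) (xi1 p) Rc_gt0.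
have := @mobius_shift _ Rc (xi2 k) (xi1 k) (xi2 p) Rc_gt0.
have := xi1_gt0 p0; have := xi2_gt0 p0; have := xi1_gt0 k0; have := xi2_gt0 k0.
move=> b0 a0 B0 A0 /(_ (ltW b0) (ltW a0) B0) + /(_ (ltW a0) (ltW b0) A0).
have u0 : 0 <= xi1 p / (xi1 p + Rc) by rewrite divr_ge0//; lra.
have u1 : xi1 p / (xi1 p + Rc) <= 1 by rewrite ler_pdivrMr; lra.
have v0 : 0 <= xi2 p / (xi2 p + Rc) by rewrite divr_ge0//; lra.
have v1 : xi2 p / (xi2 p + Rc) <= 1 by rewrite ler_pdivrMr; lra.
have lt1 : factor2 k p <= 1 by rewrite ler_pdivrMr; lra.
have e0 : 0 <= (xi1 k + xi2 k) / Rc by rewrite divr_ge0//; lra.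
rewrite [xi2 k + xi1 k]addrC => h1 h2 f0 g0; rewrite -[2 * _ / _]mulrA.
by apply: mulr_sub_le => //; apply/andP.
Qed.
(** [Gkmax] is the inverse of a product [X * Y] of two increasing functions that
are at least 1.  It is enough to let [X] alone grow: it contributes the slope of
[phihat_sub_ge], and both values of [X * Y] are at most the one at [q]. *)
Lemma Gkmax_sub_ge q : 0 < q ->
  exists2 m, 0 < m &
    forall p, 0 < p -> p <= q -> m * (q - p) <= rhoinf p - rhoinf q.
Proof.
move=> q0; have r0 := Rc_gt0.
pose X k := Rc * kappa1 * phihat c1 kappa1 k + 1.
pose Y k := Rc * kappa2 * phihat c2 kappa2 k + 1.
have rk1 : 0 < Rc * kappa1 by rewrite mulr_gt0.
have rk2 : 0 < Rc * kappa2 by rewrite mulr_gt0.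
have X1 k : 1 <= X k by rewrite lerDr mulr_ge0 ?sqrtr_ge0 ?ltW.
have Y1 k : 1 <= Y k by rewrite lerDr mulr_ge0 ?sqrtr_ge0 ?ltW.
have X0 k : 0 < X k by apply: lt_le_trans (X1 k).
have Y0 k : 0 < Y k by apply: lt_le_trans (Y1 k).
have phi0 := phihat_gt0 c1_ge0 kappa1_gt0 q0.
exists (Rc * kappa1 * (q / (2 * phihat c1 kappa1 q)) / (X q * Y q) ^+ 2).
  by rewrite !(divr_gt0, mulr_gt0, exprn_gt0).
move=> p p0 pq.
have XX : Rc * kappa1 * (q / (2 * phihat c1 kappa1 q)) * (q - p) <= X q - X p.
  have := phihat_sub_ge c1_ge0 kappa1_gt0 p0 pq.
  rewrite -(ler_pM2l rk1) mulrA => /le_trans; apply.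
  by rewrite /X opprD addrACA subrr addr0 mulrBr.
have XX0 : X p <= X q.
  rewrite -subr_ge0; apply: le_trans XX.
  by rewrite !mulr_ge0 ?invr_ge0 ?mulr_ge0 ?subr_ge0// ltW.
have YY : Y p <= Y q.
  rewrite lerD2r ler_pM2l//; move: pq; rewrite le_eqVlt => /predU1P[->//|pq].
  by rewrite ltW// phihat_lt.
have -> : rhoinf p - rhoinf q = (X q * Y q - X p * Y p) / (X p * Y p * (X q * Y q)).
  by rewrite /Gkmax -/(X p) -/(X q) -/(Y p) -/(Y q); field; rewrite !gt_eqF.
rewrite mulrAC; apply: ler_pM.
- by rewrite !mulr_ge0 ?invr_ge0 ?mulr_ge0 ?subr_ge0// ltW.
- by rewrite invr_ge0 exprn_ge0// ltW// mulr_gt0.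
- apply: le_trans XX _; move: (X p) (X q) (Y p) (Y q) (X0 p) XX0 (Y1 p) YY.
  by move=> x x' y y' ? ? ? ?; nra.
- rewrite lef_pV2 ?posrE ?exprn_gt0 ?mulr_gt0// expr2 ler_wpM2r//.
    by rewrite ltW// mulr_gt0.
  by apply: ler_pM => //; rewrite ltW.
Qed.

(** * Equioscillation *)

Lemma Gkmax_continuous : continuous rhoinf.
Proof.
move=> x; apply: cvgM; first exact: cvg_cst.
have pos c kappa : 0 < kappa -> 0 < Rc * kappa * phihat c kappa x + 1.
  by move=> k0; rewrite ltr_wpDl// !mulr_ge0 ?sqrtr_ge0// ltW.
apply: cvgV; first by rewrite gt_eqF// mulr_gt0// pos.
have F c kappa :
    {for x, continuous (fun y => Rc * kappa * phihat c kappa y + 1)}.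
  apply: cvgD; last exact: cvg_cst.
  by apply: cvgM; [exact: cvg_cst|exact: phihat_continuous].
by apply: cvgM; exact: F.
Qed.

Lemma rhoSR_continuous_parameter a b k : 0 < a -> 0 < k ->
  {within `[a, b], continuous (rho k)}.
Proof.
move=> a0 k0.
have := @rhoSR_continuous _ Rc kappa1 kappa2 c1 c2 a b k.
move=> /(_ Rc_gt0 kappa1_gt0 kappa2_gt0 c1_ge0 c2_ge0 a0 k0).
apply: subspace_eq_continuous => p; rewrite inE/= in_itv/= => /andP[ap _].
by rewrite /from_subspace /= rhoSR_sym// (lt_le_trans a0).
Qed.

Lemma exists_equioscillation a b : 0 < a -> a < b ->
  exists2 p, a < p < b & rho a p = rho b p.
Proof.
move=> a0 ab; have b0 := lt_trans a0 ab.
apply: exists_crossing => //; [exact: rhoSR_continuous_parameter..| |].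
  by rewrite rhoSR_diag -(rhoSR_diag b) rhoSR_decr.
by rewrite rhoSR_diag -(rhoSR_diag a) rhoSR_incr.
Qed.

(** For large [p] the value [rhoSR a p] stays above its value [m] at [a + 1],
while [Gkmax p] tends to 0. *)
Lemma exists_limit_equioscillation a : 0 < a ->
  exists2 C, a < C & rho a C = rhoinf C.
Proof.
move=> a0; have r0 := Rc_gt0.
pose b0 := a + 1.
have ab0 : a < b0 by rewrite ltrDl.
have [m m0 mE] : exists2 m, 0 < m & rho a b0 = m.
  by exists (rho a b0) => //; rewrite -(rhoSR_diag a) rhoSR_incr.
(* At this b the bound (kappa1 * b)^-1 * xi2 a / Rc^2 on Gkmax b is below m. *)
pose b := b0 + xi2 a / (kappa1 * Rc ^+ 2 * m).
have d0 : 0 < xi2 a / (kappa1 * Rc ^+ 2 * m).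
  by apply: divr_gt0; [exact: xi2_gt0|rewrite !mulr_gt0// exprn_gt0].
have b0b : b0 < b by rewrite ltrDl.
have ab := lt_trans ab0 b0b; have bpos := lt_trans a0 ab.
have [||||C /andP[aC _] eC] := @exists_crossing _ (rho a) rhoinf a b ab.
- exact: rhoSR_continuous_parameter.
- exact/continuous_subspaceT/Gkmax_continuous.
- by rewrite rhoSR_lt_Gkmax.
- apply: lt_trans (rhoSR_incr a0 (ltW ab0) b0b); rewrite mE GkmaxE//.
  have A0 := xi1_gt0 bpos; have B0 := xi2_gt0 bpos.
  have F x y : 0 < x -> x <= y -> 0 <= x / (x + Rc) <= y / Rc.
    move=> x0 xy; have xr : 0 < x + Rc by rewrite addr_gt0.
    rewrite divr_ge0 ?(ltW x0) ?(ltW xr)//=; apply: ler_pM => //.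
    - exact: ltW.
    - by rewrite invr_ge0 ltW.
    - by rewrite lef_pV2 ?posrE// lerDr ltW.
  have /andP[? ?] := F _ _ A0 (xi_le c1_ge0 kappa1_gt0 bpos).
  have /andP[? ?] := F _ _ B0 (ltW (xi_lt c2_ge0 kappa2_gt0 a0 ab)).
  apply: (@le_lt_trans _ _ ((kappa1 * b)^-1 / Rc * (xi2 a / Rc))).
    exact: ler_pM.
  have -> : (kappa1 * b)^-1 / Rc * (xi2 a / Rc) = m * (xi2 a / (kappa1 * Rc ^+ 2 * m)) / b.
    by field; rewrite !gt_eqF.
  rewrite ltr_pdivrMr// ltr_pM2l// ltrDr.
  exact: lt_trans ab0.
by exists C.
Qed.

(** Moving the parameter away from the equioscillation point to the left raises
the value at [b], and moving it to the right raises the value at [a]. *)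
Lemma equioscillation_optimal a b p q : 0 < a -> a < p < b ->
  rho a p = rho b p -> 0 < q -> q != p ->
  rho a p < Num.max (rho a q) (rho b q).
Proof.
move=> a0 /andP[ap pb] e q0; rewrite lt_max neq_lt => /orP[qp|pq].
  by rewrite e rhoSR_decr ?orbT// ltW.
by rewrite rhoSR_incr// ltW.
Qed.

Lemma minmax_solution_equioscillation a b p q : 0 < a -> a < p < b ->
  rho a p = rho b p ->
  minmax_solution Rc kappa1 kappa2 c1 c2 a b q <-> q = p.
Proof.
move=> a0 apb e; have /andP[ap pb] := apb.
have p0 := lt_trans a0 ap; have ab := ltW (lt_trans ap pb).
have wE s : 0 < s -> max_on (fun k => `|rho k s|) a b = _ :=
  fun s0 => max_on_norm_rhoSR s0 a0 ab.
have wp : max_on (fun k => `|rho k p|) a b = rho a p.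
  by rewrite wE// -e maxxx.
split=> [[q0 /(_ p p0)]|->].
  rewrite /= wp wE// leNgt => /negP H; apply/eqP/negPn/negP => qp.
  by apply: H; exact: equioscillation_optimal.
split=> // s s0; rewrite /= wp; have [->|sp] := eqVneq s p; first by rewrite wp.
by rewrite wE// ltW// equioscillation_optimal.
Qed.

(** [p] cannot lie to the right of [C], since [rhoSR b] lies below [Gkmax] and so
meets the increasing branch of [rhoSR a] earlier.  Then
[rhoSR b p = rhoSR a p <= rhoSR a C = Gkmax C <= Gkmax p], and the two ends of
this chain differ by at most [delta]. *)
Lemma equioscillation_rate a b p C : 0 < a -> a < p < b -> a < C < b ->
  rho a p = rho b p -> rho a C = rhoinf C ->
  let delta := 2 * (xi1 b + xi2 b) / Rc in
  [/\ p <= C, rhoinf p - rhoinf C <= delta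
    & `|rho b p - rhoinf C| <= delta].
Proof.
move=> a0 /andP[ap pb] /andP[aC Cb] ep eC delta.
have p0 := lt_trans a0 ap; have C0 := lt_trans a0 aC.
have pC : p <= C.
  rewrite leNgt; apply/negP => Cp.
  have := rhoSR_incr a0 (ltW aC) Cp; rewrite ep => h1.
  have h2 := rhoSR_decr C0 Cp (ltW pb).
  have h3 := rhoSR_lt_Gkmax C0 (ltW Cb).
  by have := lt_trans (lt_trans h1 h2) h3; rewrite eC ltxx.
have le_pC : rho b p <= rhoinf C.
  rewrite -ep -eC; move: pC; rewrite le_eqVlt => /predU1P[->//|pC].
  by rewrite ltW// rhoSR_incr// ltW.
have := Gkmax_sub_rhoSR p0 (ltW pb); rewrite -/delta.
have := Gkmax_le p0 pC => h1 h2; split => //; first by lra.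
rewrite ler0_norm ?subr_le0//; lra.
Qed.

End ConvergenceFactor.

(** * The asymptotic expansion *)

Lemma eqaddO_linear (R : realType) (f : R -> R) (l K : R) :
  (\forall h \near 0^'+, `|f h - l| <= K * h) ->
  f = cst l +O_ (0^'+) (fun h : R => h).
Proof.
move=> fK; apply/eqaddOP; near=> k.
have Kk : K <= k by near: k; apply: nbhs_pinfty_ge; exact: num_real.
near=> h; have h0 : 0 < h by near: h; exact: nbhs_right_gt.
rewrite (gtr0_norm h0); apply: (@le_trans _ _ (K * h)).
  by near: h.
by rewrite ler_pM2r.
Unshelve. all: by end_near. Qed.

Theorem theorem3p6 (R : realType) (Rc kappa1 kappa2 c1 c2 kmin : R)
    (hRc : 0 < Rc) (hkappa1 : 0 < kappa1) (hkappa2 : 0 < kappa2)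
    (hc1 : 0 <= c1) (hc2 : 0 <= c2) (hkmin : 0 < kmin) :
  exists Cp : R,
    [/\ 0 < Cp,
        forall C : R, 0 < C ->
          (Gkmin Rc kappa1 kappa2 c1 c2 kmin C = Gkmax Rc kappa1 kappa2 c1 c2 C
           <-> C = Cp),
        0 < Gkmax Rc kappa1 kappa2 c1 c2 Cp < 1,
        \forall h \near 0^'+, exists! p : R,
          minmax_solution Rc kappa1 kappa2 c1 c2 kmin (pi / h) p
      & forall pstar : R -> R,
          (\forall h \near 0^'+,
             minmax_solution Rc kappa1 kappa2 c1 c2 kmin (pi / h) (pstar h)) ->
          pstar = cst Cp +O_ (0^'+) (fun h : R => h) /\
          (fun h : R =>
             max_on (fun k : R => rhoSR Rc kappa1 kappa2 c1 c2 k (pstar h))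
               kmin (pi / h))
          = cst (Gkmax Rc kappa1 kappa2 c1 c2 Cp) +O_ (0^'+) (fun h : R => h)].
Proof.
have [C kminC eC] := exists_limit_equioscillation
  hRc hkappa1 hkappa2 hc1 hc2 hkmin.
have C0 := lt_trans hkmin kminC.
set rho := rhoSR Rc kappa1 kappa2 c1 c2 in eC *.
set rhoinf := Gkmax Rc kappa1 kappa2 c1 c2 in eC *.
have small : \forall h \near 0^'+, 0 < h /\ C < pi / h.
  near=> h; have h0 : 0 < h by near: h; exact: nbhs_right_gt.
  split=> //; rewrite ltr_pdivlMr// mulrC -ltr_pdivlMr//.
  by near: h; apply: nbhs_right_lt; rewrite divr_gt0// pi_gt0.
exists C; split=> //.
- move=> D D0; rewrite GkminE// -/rho -/rhoinf; split=> [eD|->//].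
  have kminD : kmin < D.
    rewrite ltNge; apply/negP => Dk.
    by have := rhoSR_lt_Gkmax hRc hkappa1 hkappa2 hc1 hc2 D0 Dk;
      rewrite -/rho -/rhoinf eD ltxx.
  (* Gkmin - Gkmax is strictly increasing to the right of kmin. *)
  have no_two x y : kmin < x -> x < y -> rho kmin x = rhoinf x ->
      rho kmin y = rhoinf y -> False.
    move=> kx xy ex ey; have x0 := lt_trans hkmin kx.
    have := rhoSR_incr hRc hkappa1 hkappa2 hc1 hc2 hkmin (ltW kx) xy.
    rewrite -/rho ex ey ltNge => /negP; apply.
    exact/ltW/Gkmax_lt.
  by have [/no_two|/no_two|//] := ltgtP D C; case.
- by rewrite Gkmax_gt0// Gkmax_lt1.
- apply: filterS small => h [h0 Ch].
  have [p kpk ep] := exists_equioscillation hRc hkappa1 hkappa2 hc1 hc2 hkmin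
    (lt_trans kminC Ch).
  have E q : minmax_solution Rc kappa1 kappa2 c1 c2 kmin (pi / h) q <-> q = p.
    exact: (minmax_solution_equioscillation hRc hkappa1 hkappa2 hc1 hc2).
  by exists p; split=> [|q /E ->//]; apply/E.
move=> pstar opt.
have [m m0 slope] := Gkmax_sub_ge hRc hkappa1 hkappa2 hc1 hc2 C0.
pose K := 2 * ((kappa1 * pi)^-1 + (kappa2 * pi)^-1) / Rc.
have near_opt : \forall h \near 0^'+,
    `|pstar h - C| <= K / m * h /\
    `|max_on (fun k => rho k (pstar h)) kmin (pi / h) - rhoinf C| <= K * h.
  apply: filterS2 opt small => h sol [h0 Ch].
  have kminmax := lt_trans kminC Ch; have kmax0 := lt_trans hkmin kminmax.
  have [p kpk ep] := exists_equioscillation hRc hkappa1 hkappa2 hc1 hc2 hkmin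
    kminmax.
  have pE : pstar h = p.
    exact: (iffLR (minmax_solution_equioscillation hRc hkappa1 hkappa2 hc1 hc2
      _ hkmin kpk ep) sol).
  have p0 : 0 < p by have /andP[kp _] := kpk; exact: lt_trans kp.
  have kCk : kmin < C < pi / h by rewrite kminC.
  have [pC d1 d2] := equioscillation_rate hRc hkappa1 hkappa2 hc1 hc2
    hkmin kpk kCk ep eC.
  have dK : 2 * (xi c1 kappa1 (pi / h) + xi c2 kappa2 (pi / h)) / Rc <= K * h.
    have xiK c kappa : 0 <= c -> 0 < kappa ->
        xi c kappa (pi / h) <= (kappa * pi)^-1 * h.
      by move=> c0 k0; rewrite (le_trans (xi_le c0 k0 kmax0))// mulrA invfM invrK.
    rewrite /K [leRHS]mulrAC ler_pM2r ?invr_gt0// -[leRHS]mulrA ler_pM2l// [leRHS]mulrDl.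
    by apply: lerD; exact: xiK.
  rewrite pE max_on_rhoSR//; last exact: ltW.
  rewrite -/rho in ep d2 *; rewrite ep maxxx; split; last exact: le_trans dK.
  rewrite ler0_norm ?subr_le0// opprB mulrAC ler_pdivlMr// mulrC.
  exact: le_trans (slope _ p0 pC) (le_trans d1 dK).
split; [apply: (@eqaddO_linear _ _ _ (K / m))|apply: (@eqaddO_linear _ _ _ K)].
  by apply: filterS near_opt => h [].
by apply: filterS near_opt => h [].
Unshelve. all: by end_near. Qed.
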